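(* Assume $\|\rho_i\|:=\sup_{x_i,z_i\in\mathsf{X}_i}\rho_i(x_i,z_i)<\infty$ for all $i\in T$, and let $\mu$ be a Borel probability measure on $\mathsf{X}$. For each index $i\in T$ and for each pair $x,z\in\mathsf{X}$ of configurations with $x^{T\setminus\{i\}}=z^{T\setminus\{i\}}$ and $x_i\ne z_i$, pick an arbitrary coupling $\mathbf{P}^{[i]}_{x,z}$ of the conditional laws $\mu^{(i,n]}(\cdot|x^{[i]})$ and $\mu^{(i,n]}(\cdot|z^{[i]})$. For $i,j\in T$ define $$V^{(i+1)}_{ij}=\begin{cases}0,& i>j\\ 1,& i=j\\ \displaystyle\sup_{x,z\in\mathsf{X}:\ x^{T\setminus\{i\}}=z^{T\setminus\{i\}},\ x_i\neq z_i}\frac{\int\rho_j\,d\mathbf{P}^{[i]}_{x,z}}{\rho_i(x_i,z_i)},& i<j,\end{cases}\qquad \Gamma_{ij}=\|\rho_i\|\,V^{(i+1)}_{ij},$$ where $\int\rho_j\,d\mathbf{P}^{[i]}_{x,z}=\int\rho_j(u_j,y_j)\,\mathbf{P}^{[i]}_{x,z}(du^{(i,n]},dy^{(i,n]})$. Then, for any measurable $f:\mathsf{X}\to\mathbb{R}$ that is Lipschitz with respect to $\rho$ and for any $t\ge 0$, $$\mathbb{P}_\mu\Big\{|f(X)-\mathbb{E}_\mu[f(X)]|\ge t\Big\}\le 2\exp\left(-\frac{2t^2}{\|\Gamma\boldsymbol{\delta}(f)\|^2_{\ell^2(T)}}\right).$$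
   Context: Let $T=\{1,\dots,n\}$, $[i]=\{1,\dots,i\}$, $(i,n]=\{i+1,\dots,n\}$. For each $i\in T$, $\mathsf{X}_i$ is a Polish space with Borel $\sigma$-field $\mathcal{B}_i$ and a metric $\rho_i$ on $\mathsf{X}_i$ that is $\mathcal{B}_i\otimes\mathcal{B}_i$-measurable (not necessarily the one metrizing the topology). For $I\subseteq T$, $\mathsf{X}^I=\prod_{i\in I}\mathsf{X}_i$ with the product $\sigma$-field; $\mathsf{X}=\mathsf{X}^T$ carries the metric $\rho(x,z)=\sum_{i\in T}\rho_i(x_i,z_i)$. $x^I$ denotes the restriction of $x$ to the coordinates in $I$. $X=(X_i)_{i\in T}$ is a random element of $\mathsf{X}$ with law $\mu$, and $\mu^{I}(\cdot|x^J)$ is the regular conditional law of $X^I$ given $X^J=x^J$ (a fixed version). A coupling of two probability measures on $\mathsf{X}^{(i,n]}$ is a probability measure on $\mathsf{X}^{(i,n]}\times\mathsf{X}^{(i,n]}$ with these marginals. The local oscillation of a measurable $f:\mathsf{X}\to\mathbb{R}$ at $i$ is $$\delta_i(f)=\sup_{x,z\in\mathsf{X}:\ x^{T\setminus\{i\}}=z^{T\setminus\{i\}}}\frac{|f(x)-f(z)|}{\rho_i(x_i,z_i)},\qquad 0/0=0,$$ and $\boldsymbol{\delta}(f)=(\delta_i(f))_{i\in T}$. A supremum over the empty set is $0$; the suprema defining $V^{(i+1)}_{ij}$ may be $+\infty$, with the convention $0\cdot\infty=0$. *)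

(* Defs.v *)
From HB Require Import structures.
From mathcomp Require Import all_boot all_order all_algebra.
From mathcomp Require Import all_classical all_reals all_analysis.

Set Implicit Arguments.
Unset Strict Implicit.
Unset Printing Implicit Defensive.

Import Order.TTheory GRing.Theory Num.Theory.
Import numFieldNormedType.Exports.

Local Open Scope classical_set_scope.
Local Open Scope ring_scope.

Definition is_metric (R : realType) (T : Type) (d : T -> T -> R) : Prop :=
  [/\ forall x y, 0 <= d x y,
      forall x y, d x y = 0 <-> x = y,
      forall x y, d x y = d y x
    & forall x y z, d x z <= d x y + d y z].

Definition polish (R : realType) (T : topologicalType) : Prop :=
  (exists2 D : set T, countable D & dense D) /\
  exists d : T -> T -> R,
    [/\ is_metric d,
        forall (x : T) (A : set T),
          nbhs x A <-> exists2 e : R, 0 < e & [set y | d x y < e] `<=` A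
      & forall u : nat -> T,
          (forall e : R, 0 < e -> exists N : nat,
             forall m k : nat, (N <= m)%N -> (N <= k)%N -> d (u m) (u k) < e) ->
          exists l : T, u @ \oo --> l].

Definition borel (T : ptopologicalType) := g_sigma_algebraType (@open T).

(* Product of the spaces [E j], with the product sigma-field of the Borel
   sigma-fields, i.e. the one generated by the coordinate maps. *)
Definition coord_sets (J : Type) (E : J -> ptopologicalType) :
    set (set (forall j, E j)) :=
  \bigcup_(j in [set: J])
    preimage_set_system [set: forall k, E k] (fun x => x j)
      (measurable : set (set (borel (E j)))).

Definition prodspace (J : Type) (E : J -> ptopologicalType) :=
  g_sigma_algebraType (@coord_sets J E).

Section Configurations.
Variables (n : nat) (E : 'I_n -> ptopologicalType).

Definition subspace_of (J : pred 'I_n) :=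
  prodspace (fun j : {j : 'I_n | J j} => E (val j)).

Definition restr (J : pred 'I_n) (x : prodspace E) : subspace_of J :=
  fun j => x (val j).

(* Coordinates are numbered from 0, so that [upto i] is the initial segment
   ending with (and containing) [i], and [after i] is its complement. *)
Definition upto (i : 'I_n) : pred 'I_n := fun j => (j <= i)%N.
Definition after (i : 'I_n) : pred 'I_n := fun j => (i < j)%N.

Definition agree_off (i : 'I_n) (x z : prodspace E) : Prop :=
  forall j, j != i -> x j = z j.

End Configurations.
Arguments restr {n E} J x.

Local Open Scope ereal_scope.

(* [k] is a version of the regular conditional law of [x^I] given [x^J]
   when [x] has law [mu]. *)
Definition regular_cond_law (R : realType) (n : nat)
    (E : 'I_n -> ptopologicalType) (mu : probability (prodspace E) R)
    (I J : pred 'I_n)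
    (k : R.-pker (subspace_of E J) ~> (subspace_of E I)) : Prop :=
  forall (A : set (subspace_of E J)) (B : set (subspace_of E I)),
    measurable A -> measurable B ->
    mu ((restr J @^-1` A) `&` (restr I @^-1` B)) =
    \int[mu]_(x in restr J @^-1` A) k (restr J x) B.

Definition is_coupling (R : realType) d (T : measurableType d)
    (P : probability (T * T)%type R) (m1 m2 : {measure set T -> \bar R}) : Prop :=
  (forall A : set T, measurable A -> P (fst @^-1` A) = m1 A) /\
  (forall A : set T, measurable A -> P (snd @^-1` A) = m2 A).

(* Supremum of a set of nonnegative extended reals; it is 0 (and not -oo) on
   the empty set. *)
Definition sup_nneg (R : realType) (S : set (\bar R)) : \bar R :=
  ereal_sup (0 |` S).

Section Concentration.
Variables (R : realType) (n : nat) (E : 'I_n -> ptopologicalType).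
Variable rho : forall i : 'I_n, E i -> E i -> R.

Definition rho_sum (x z : prodspace E) : R := (\sum_(i < n) rho (x i) (z i))%R.

Definition lipschitz_rho (f : prodspace E -> R) : Prop :=
  exists L : R, forall x z, (`|f x - f z| <= L * rho_sum x z)%R.

Definition diam (i : 'I_n) : \bar R :=
  ereal_sup [set (rho p.1 p.2)%:E | p in [set: E i * E i]].

(* The division is that of [R], for which 0 / 0 = 0. *)
Definition local_osc (f : prodspace E -> R) (i : 'I_n) : \bar R :=
  ereal_sup [set (`|f p.1 - f p.2| / rho (p.1 i) (p.2 i))%:E%R
            | p in [set p | agree_off i p.1 p.2]].

Variable P : forall i : 'I_n, prodspace E -> prodspace E ->
  probability (subspace_of E (after i) * subspace_of E (after i))%type R.

Definition coupling_cost (i j : 'I_n) (h : after i j) (x z : prodspace E) :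
    \bar R :=
  \int[P i x z]_p (rho (p.1 (exist _ j h)) (p.2 (exist _ j h)))%:E.

Definition Vmx (i j : 'I_n) : \bar R :=
  match ltngtP i j with
  | CompareNatLt h =>
      sup_nneg [set coupling_cost h p.1 p.2 / (rho (p.1 i) (p.2 i))%:E
           | p in [set p | agree_off i p.1 p.2 /\ p.1 i <> p.2 i]]
  | CompareNatGt _ => 0
  | CompareNatEq _ => 1
  end.

Definition Gamma (i j : 'I_n) : \bar R := diam i * Vmx i j.

End Concentration.

Definition mulmv (R : realType) (n : nat) (A : 'I_n -> 'I_n -> \bar R)
    (v : 'I_n -> \bar R) (i : 'I_n) : \bar R := \sum_(j < n) A i j * v j.

Definition l2norm_sq (R : realType) (n : nat) (v : 'I_n -> \bar R) : \bar R :=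
  \sum_(i < n) (v i) ^+ 2.

(* Main.v *)
From HB Require Import structures.
Require Import Defs.
From mathcomp Require Import all_boot all_order all_algebra.
From mathcomp Require Import all_classical all_reals all_analysis.
From mathcomp Require Import measurable_realfun ring lra.
Import Order.TTheory GRing.Theory Num.Theory.
Import numFieldNormedType.Exports.

(* The Doob martingale of f along the coordinates has increments whose
   conditional range is at most c_i = (Gamma delta(f))_i, so conditional
   Hoeffding bounds multiply to E exp(l (f - E f)) <= exp(l^2 sum_i c_i^2 / 8),
   and Chernoff's bound with l = 4t / sum_i c_i^2 concludes.  The range bound is
   where the couplings enter: if x and z differ only at i, then
   E[f | x^{[i]}] - E[f | z^{[i]}] is the integral of
   f(x^{[i]} u) - f(z^{[i]} y) against P^{[i]}_{x,z}(du, dy), and f is changed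
   one coordinate at a time, at a cost delta_j(f) rho_j for the coordinate j. *)

Set Implicit Arguments.
Unset Strict Implicit.
Unset Printing Implicit Defensive.

Local Open Scope classical_set_scope.
Local Open Scope ring_scope.

(** The given versions of the conditional laws fit together only up to null sets: averaging the
    version of E[f | x^{[i]}] over the law one level below need not return, at every point, the
    version of that level. The couplings, however, concern exactly these versions, at every pair
    [x], [z]. So no version is modified: Hoeffding's lemma is applied pointwise, around the average,
    and the discrepancy is absorbed after integration against [mu], by convexity of the exponential.
    The coupled distance in the coordinate j is at most rho_i(x_i, z_i) V_ij; an increment has to be
    bounded over all values of the coordinate i at once, so rho_i(x_i, z_i) gives way to the
    diameter, and Gamma appears. The constant 1/8 is half of 1/4, the largest variance of a
    Bernoulli variable. Conditioning is used on nonnegative functions only, which keeps its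
    identities free of integrability conditions; a general f is shifted. If some (Gamma delta(f))_i
    is infinite, the right-hand side is 2. *)

(** * Exponential moment of a Bernoulli variable *)

Lemma nonneg_of_deriv_ge0 {R : realType} {g dg : R -> R} :
  (forall u : R, is_derive u (1:R) g (dg u)) ->
  (forall u, 0 <= u -> 0 <= dg u) ->
  forall u, 0 <= u -> g 0 <= g u.
Proof.
move=> gd dg0 u u0.
apply: (@ger0_derive1_ndecry R g 0) => //.
- move=> x; rewrite in_itv/= andbT => x0.
  by rewrite derive1E (@derive_val _ _ _ _ _ _ _ (gd x)) dg0// ltW.
- apply: continuous_subspaceT => x.
  by apply/differentiable_continuous/derivable1_diffP.
Qed.

Section bernoulli.
Variables (R : realType) (p : R).
Hypothesis p01 : 0 <= p <= 1.
Let D (v : R) : R := 1 - p + p * expR v.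

Let D0 v : 0 < D v.
Proof.
case/andP: p01 => p0 p1.
rewrite /D; have := expR_gt0 v; move: (expR v) => e e0.
have [->|pn0] := eqVneq p 0; first by lra.
have : 0 < p by rewrite lt_neqAle eq_sym pn0.
by nra.
Qed.

Let dD (v : R) : is_derive v (1:R) D (p * expR v).
Proof.
have d := @is_deriveD R R R (cst (1 - p)) (p *: expR) v 1 _ _
  (@is_derive_cst R R R (1 - p) v 1)
  (@is_deriveZ R R R expR p v 1 _ (is_derive_expR v)).
by rewrite add0r in d.
Qed.

(** Derivative of [p * v + v ^+ 2 / 8 - ln (D v)], with [p * expR v / D v] rewritten as
    [1 - (1 - p) / D v]. *)
Let psi (v : R) : R := p - 1 + 4^-1 * v + (1 - p) * (D v)^-1.

Let dpsi (v : R) : R := 1 / 4 - (1 - p) * (p * expR v) / (D v) ^+ 2.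

Let is_derive_psi (v : R) : is_derive v (1:R) psi (dpsi v).
Proof.
have Dn0 := lt0r_neq0 (D0 v).
have dV := is_deriveV Dn0 (dD v).
have d := @is_deriveD R R R _ _ v 1 _ _
  (@is_deriveD R R R _ _ v 1 _ _ (@is_derive_cst R R R (p - 1) v 1)
    (@is_deriveZ R R R id 4^-1 v 1 _ (is_derive_id _ _)))
  (is_deriveZ (1 - p) dV).
apply: (@is_derive_eq R R R _ _ _ _ _ d).
rewrite /dpsi /GRing.scale/=.
by move: (expR v) (D v) Dn0 => e De Dn0; field.
Qed.

Let psi_ge0 (v : R) : 0 <= v -> 0 <= psi v.
Proof.
move=> v0; have <- : psi 0 = 0.
  by rewrite /psi /D expR0; field; rewrite -addrA addNr addr0 oner_neq0.
apply: (nonneg_of_deriv_ge0 is_derive_psi) => // w _.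
rewrite /dpsi subr_ge0 ler_pdivrMr ?exprn_gt0//.
rewrite /D; move: (expR w) => e.
(* Arithmetic-geometric mean for [1 - p] and [p * e], the two summands of [D]: this is where 1/4
   comes from. *)
have := sqr_ge0 (1 - p - p * e); lra.
Qed.

Let q (v : R) : R := - (p * v + v * v / 8).

Let is_derive_q (v : R) : is_derive v (1:R) q (- (p + v / 4)).
Proof.
have d := @is_deriveN R R R _ v 1 _ (@is_deriveD R R R _ _ v 1 _ _
  (@is_deriveZ R R R id p v 1 _ (is_derive_id _ _))
  (@is_deriveM R R _ _ v 1 _ _
    (@is_deriveM R R id id v 1 _ _ (is_derive_id _ _) (is_derive_id _ _))
    (@is_derive_cst R R R (8^-1) v 1))).
apply: (@is_derive_eq R R R _ _ _ _ _ d).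
by rewrite /GRing.scale/=; field.
Qed.

Lemma bernoulli_mgf_le (u : R) : 0 <= u ->
  1 - p + p * expR u <= expR (p * u + u ^+ 2 / 8).
Proof.
move=> u0.
(* Product form of the logarithmic inequality: no [ln] has to be differentiated, and the derivative
   of [F] is [psi] times the positive factor [expR (q v) * D v]. *)
pose F (v : R) : R := - (expR (q v) * D v).
suff : F 0 <= F u.
  rewrite /F /D /q expR0 lerN2 !mulr0 mul0r addr0 oppr0 expr2 expR0.
  by rewrite expRN -ler_pdivlMl ?invr_gt0 ?expR_gt0// invrK mulr1; lra.
apply: (@nonneg_of_deriv_ge0 R F (fun w => expR (q w) * D w * psi w)) => //
  [w|w w0].
  have d := @is_deriveN R R R _ w 1 _ (@is_deriveM R R _ _ w 1 _ _
    (@is_derive1_comp R expR q w _ _ (is_derive_expR (q w)) (is_derive_q w))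
    (dD w)).
  apply: (@is_derive_eq R R R _ _ _ _ _ d).
  rewrite /psi /GRing.scale/= /D; have := lt0r_neq0 (D0 w); rewrite /D.
  by move: (expR w) (expR (q w)) => e1 e2 n0; field.
by rewrite !mulr_ge0 ?expR_ge0 ?psi_ge0// ltW.
Qed.

End bernoulli.

Local Open Scope ereal_scope.

Lemma measurable_superlevel d (T : measurableType d) (R : realType) (u : T -> R)
    (t : R) :
  measurable_fun setT u -> measurable [set x | t <= u x]%R.
Proof.
move=> mu; rewrite (_ : mkset _ = u @^-1` [set` `[t, +oo[]).
  by rewrite -[X in measurable X]setTI; exact: mu.
by apply/seteqP; split => x; rewrite /= in_itv/= andbT.
Qed.

(** * Hoeffding's lemma and convexity under a measure of mass one *)

Section unit_mass.
Context d (T : measurableType d) (R : realType) (m : {measure set T -> \bar R}).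
Hypothesis m1 : m setT = 1.

Lemma integral_cst_mass1 (a : \bar R) : \int[m]_y a = a.
Proof. by rewrite integral_cst// m1 mule1. Qed.

Lemma integrable_of_norm_bound (h : T -> R) (M : R) :
  measurable_fun setT h -> (forall y, `|h y| <= M)%R ->
  m.-integrable setT (EFin \o h).
Proof.
move=> mh hM; apply: measurable_bounded_integrable => //.
  by rewrite m1 ltry.
exists M; split; first exact: num_real.
by move=> M' MM' y _; rewrite /= (le_trans (hM y))// ltW.
Qed.

Section affine.
Context (h : T -> R) (M : R).
Hypotheses (mh : measurable_fun setT h) (h_bnd : forall y, (0 <= h y <= M)%R).

Lemma integrable_of_bounds : m.-integrable setT (EFin \o h).
Proof.
apply: (@integrable_of_norm_bound _ M mh) => y.
by have /andP[h0 hM] := h_bnd y; rewrite ger0_norm.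
Qed.

Lemma integral_fin_of_bounds :
  \int[m]_y (h y)%:E = (fine (\int[m]_y (h y)%:E))%:E.
Proof. by rewrite fineK//; exact: integrable_fin_num integrable_of_bounds. Qed.

Lemma integral_affine (a b : R) :
  \int[m]_y (a + b * h y)%:E = (a + b * fine (\int[m]_y (h y)%:E))%:E.
Proof.
under eq_integral do rewrite EFinD EFinM.
have mc : m.-integrable setT (cst a%:E).
  by apply: (@integrable_of_norm_bound (cst a) `|a|%R).
have mbh : m.-integrable setT (fun y => b%:E * (h y)%:E).
  by apply: integrableZl => //; exact: integrable_of_bounds.
rewrite (integralD measurableT mc mbh) integral_cst// m1 mule1.
rewrite (integralZl measurableT integrable_of_bounds).
by rewrite /= {1}integral_fin_of_bounds -EFinM -EFinD.
Qed.

End affine.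

(** The tangent of [expR] at [q * u] lies below [expR] at 0 and at [u]; with weights [1 - q] and [q]
    the linear terms cancel. *)
Lemma expR_chord_le (q u : R) : (0 <= q <= 1)%R ->
  (expR (q * u) <= 1 - q + q * expR u)%R.
Proof.
move=> /andP[q0 q1].
have e0 := expR_gt0 (q * u).
have t1 : (expR (q * u) * (1 - q * u) <= 1)%R.
  have := expR_ge1Dx (- (q * u)); rewrite -(ler_pM2l e0).
  by rewrite -expRD addrN expR0.
have t2 : (expR (q * u) * (1 + (u - q * u)) <= expR u)%R.
  have := expR_ge1Dx (u - q * u); rewrite -(ler_pM2l e0).
  by rewrite -expRD subrKC.
move: (expR (q * u)) (expR u) e0 t1 t2 => e e' e0 t1 t2.
have := ler_wpM2l q0 t2.
have q1' : (0 <= 1 - q)%R by rewrite subr_ge0.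
have := ler_wpM2l q1' t1.
lra.
Qed.

(** The values lie between [a], the infimum of [h], and [a + c]. The chord of the exponential over
    this interval bounds the moment by that of the variable on the two endpoints with the same mean:
    an affine image of a Bernoulli variable with parameter [p = (e - a) / c]. *)
Lemma hoeffding_mgf (h : T -> R) (c l : R) :
  measurable_fun setT h -> (forall y, 0 <= h y)%R ->
  (forall y y', h y <= h y' + c)%R -> (0 <= l)%R ->
  \int[m]_y (expR (l * h y))%:E <=
  (expR (l * fine (\int[m]_y (h y)%:E) + l ^+ 2 * c ^+ 2 / 8))%:E.
Proof.
move=> mh h0 hc l0.
have c0 : (0 <= c)%R by have := hc point point; rewrite lerDl.
pose a := inf (range h).
have nh : range h !=set0 by exists (h point), point.
have ah y : (a <= h y)%R.
  by apply: ge_inf; [exists 0%R => _ [z _ <-] | exists y].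
have hb y : (h y <= a + c)%R.
  rewrite -lerBlDr; apply: lb_le_inf => // _ [z _ <-].
  by rewrite lerBlDr.
have bnd y : (0 <= h y <= a + c)%R by rewrite h0 hb.
set e := fine _.
have aff := integral_affine mh bnd.
have [ae eb] : (a <= e /\ e <= a + c)%R.
  split.
    rewrite -subr_ge0 -lee_fin.
    have -> : (e - a)%:E = \int[m]_y (- a + 1 * h y)%:E.
      by rewrite aff mul1r addrC.
    by apply: integral_ge0 => y _; rewrite lee_fin mul1r addrC subr_ge0.
  rewrite -subr_ge0 -lee_fin.
  have -> : (a + c - e)%:E = \int[m]_y (a + c + (-1) * h y)%:E.
    by rewrite aff mulN1r.
  by apply: integral_ge0 => y _; rewrite lee_fin mulN1r subr_ge0.
have mexp : measurable_fun setT (fun y => (expR (l * h y))%:E).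
  apply/measurable_EFinP/measurableT_comp => //.
  exact: measurable_funM.
(* With zero range [h] is constant, and the quotients by [c] used below would be meaningless. *)
have [c00|cn0] := eqVneq c 0%R.
  have he y : h y = e.
    apply/eqP; rewrite eq_le; move: (ah y) (hb y) ae eb.
    by rewrite c00 addr0; lra.
  under eq_integral do rewrite he.
  by rewrite integral_cst// m1 mule1 c00 expr0n/= mulr0 mul0r addr0.
have cp : (0 < c)%R by rewrite lt_neqAle eq_sym cn0.
pose u := (l * c)%R; pose p := ((e - a) / c)%R.
(* Once the factor [expR (l * a)] is taken out, [B] is the slope of the chord as a function of
   [h y]. *)
pose B := ((expR u - 1) / c)%R.
have key y : (expR (l * h y) <=
    expR (l * a) * (1 - a * B) + expR (l * a) * B * h y)%R.
  pose q := ((h y - a) / c)%R.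
  have -> : (l * h y = l * a + q * u)%R by rewrite /q /u; field.
  rewrite expRD -mulrA -mulrDr ler_pM2l ?expR_gt0//.
  apply: (le_trans (expR_chord_le u _)).
    by rewrite /q divr_ge0 ?subr_ge0//= ler_pdivrMr// mul1r lerBlDl.
  rewrite le_eqVlt; apply/orP; left; apply/eqP.
  by rewrite /q /B; field.
pose A := expR (l * a).
apply: (@le_trans _ _ (\int[m]_y (A * (1 - a * B) + A * B * h y)%:E)).
  apply: ge0_le_integral => //.
  - apply/measurable_EFinP.
    apply: (@measurable_funD _ _ R setT (cst (A * (1 - a * B))%R)) => //.
    exact: measurable_funM.
  - by move=> y _; rewrite lee_fin; exact: key.
rewrite aff lee_fin.
have -> : (l * e + l ^+ 2 * c ^+ 2 / 8 = l * a + (p * u + u ^+ 2 / 8))%R.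
  by rewrite /p /u; field.
rewrite -mulrA -mulrDr expRD ler_pM2l ?expR_gt0//.
apply: le_trans (bernoulli_mgf_le _ _); last 2 first.
- by rewrite /p divr_ge0 ?subr_ge0//= ler_pdivrMr// mul1r lerBlDl.
- by rewrite mulr_ge0.
rewrite le_eqVlt; apply/orP; left; apply/eqP.
by rewrite -/e /p /B; field.
Qed.

Lemma ge0_integralD_real (u v : T -> R) :
  measurable_fun [set: T] u -> measurable_fun [set: T] v ->
  (forall x, 0 <= u x)%R -> (forall x, 0 <= v x)%R ->
  \int[m]_x (u x + v x)%:E = \int[m]_x (u x)%:E + \int[m]_x (v x)%:E.
Proof.
move=> mu mv u0 v0; under eq_integral do rewrite EFinD.
have mu2 : measurable_fun [set: T] (EFin \o u) by exact/measurable_EFinP.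
have mv2 : measurable_fun [set: T] (EFin \o v) by exact/measurable_EFinP.
by apply: (ge0_integralD m measurableT _ mu2 _ mv2) => x _; rewrite lee_fin.
Qed.

(* Convexity of [exp], the first-order term at [h] having integral zero. *)
Lemma mgf_le_of_tangent (h g : T -> R) (M l : R) :
  measurable_fun [set: T] h -> measurable_fun [set: T] g ->
  (forall x, 0 <= h x <= M)%R -> (forall x, 0 <= g x <= M)%R -> (0 <= l)%R ->
  \int[m]_x (l * expR (l * h x) * h x)%:E =
    \int[m]_x (l * expR (l * h x) * g x)%:E ->
  \int[m]_x (expR (l * h x))%:E <= \int[m]_x (expR (l * g x))%:E.
Proof.
move=> mh mg h_bnd g_bnd l0 tangent.
have mexp (u : T -> R) : measurable_fun [set: T] u ->
    measurable_fun [set: T] (fun x => expR (l * u x)).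
  by move=> mu; apply: measurableT_comp => //; exact: measurable_funM.
have mw : measurable_fun [set: T] (fun x => l * expR (l * h x))%R.
  by apply: measurable_funM => //; exact: mexp.
have mwg := measurable_funM mw mg.
have mwh := measurable_funM mw mh.
have w0 x : (0 <= l * expR (l * h x))%R by rewrite mulr_ge0 ?expR_ge0.
have wg0 x : (0 <= l * expR (l * h x) * g x)%R.
  by rewrite mulr_ge0//; have /andP[] := g_bnd x.
have wh0 x : (0 <= l * expR (l * h x) * h x)%R.
  by rewrite mulr_ge0//; have /andP[] := h_bnd x.
have wg_bnd x : (0 <= l * expR (l * h x) * g x <= l * expR (l * M) * M)%R.
  have /andP[g0 gM] := g_bnd x; have /andP[_ hM] := h_bnd x.
  by rewrite wg0/= ler_pM// ler_wpM2l// ler_expR ler_wpM2l.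
have wgfin : \int[m]_x (l * expR (l * h x) * g x)%:E \is a fin_num.
  by rewrite (integral_fin_of_bounds mwg wg_bnd).
rewrite -(leeD2rE _ _ wgfin) -{2}tangent.
have e0 (u : T -> R) x : (0 <= expR (l * u x))%R by exact: expR_ge0.
rewrite -(ge0_integralD_real (mexp _ mh) mwg (e0 h) wg0).
rewrite -(ge0_integralD_real (mexp _ mg) mwh (e0 g) wh0).
apply: ge0_le_integral => //.
- by move=> x _; rewrite lee_fin addr_ge0 ?expR_ge0 ?wg0.
- by apply/measurable_EFinP; apply: measurable_funD => //; exact: mexp.
- by apply/measurable_EFinP; apply: measurable_funD => //; exact: mexp.
- move=> x _; rewrite lee_fin.
  have : (expR (l * h x) * (1 + (l * g x - l * h x)) <= expR (l * g x))%R.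
    rewrite -[X in (_ <= expR X)%R](subrKC (l * h x)%R) expRD.
    by rewrite ler_pM2l ?expR_gt0// expR_ge1Dx.
  rewrite /=; move: (expR _) (expR _) => a b; lra.
Qed.

End unit_mass.

(** * Configurations cut at a coordinate *)

Section product_measurability.
Context (J : Type) (E : J -> ptopologicalType).

Lemma measurable_coord (j : J) :
  measurable_fun [set: prodspace E] (fun x => x j : borel (E j)).
Proof.
move=> _ A mA; apply: sub_sigma_algebra; exists j => //.
by exists A.
Qed.

Lemma measurable_fun_prodspace d (T : measurableType d) (g : T -> prodspace E) :
  (forall j, measurable_fun [set: T] (fun t => g t j : borel (E j))) ->
  measurable_fun [set: T] g.
Proof.
move=> mg.
apply: (@measurability _ _ T (prodspace E) setT g (@coord_sets J E)) => //.
move=> _ [_ [j _ [A mA <-]] <-].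
by rewrite setTI setTI; have := mg j measurableT A mA; rewrite setTI.
Qed.

End product_measurability.
Arguments measurable_coord {J E} j.

Section splitting.
Context {n : nat} {E : 'I_n -> ptopologicalType}.

Lemma measurable_restr (J : pred 'I_n) :
  measurable_fun [set: prodspace E] (restr J).
Proof. by apply: measurable_fun_prodspace => j; exact: measurable_coord. Qed.

Definition paste (i : 'I_n) (a : subspace_of E (upto i))
    (u : subspace_of E (after i)) : prodspace E :=
  fun j => match leqP j i with
           | LeqNotGtn h => a (exist _ j h)
           | GtnNotLeq h => u (exist _ j h)
           end.

Lemma paste_upto (i : 'I_n) (a : subspace_of E (upto i)) u j (h : upto i j) :
  paste a u j = a (exist _ j h).
Proof.
rewrite /paste; case: leqP => h'; first by rewrite (bool_irrelevance h h').
by exfalso; move: (h); rewrite /upto leqNgt h'.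
Qed.

Lemma paste_after (i : 'I_n) (a : subspace_of E (upto i)) u j (h : after i j) :
  paste a u j = u (exist _ j h).
Proof.
rewrite /paste; case: leqP => h'; last by rewrite (bool_irrelevance h h').
by exfalso; move: (h); rewrite /after ltnNge h'.
Qed.

Lemma measurable_paste (i : 'I_n) :
  measurable_fun [set: subspace_of E (upto i) * subspace_of E (after i)]
    (fun p => paste p.1 p.2).
Proof.
apply: measurable_fun_prodspace => j; have [h|h] := leqP j i.
  have -> : (fun t : subspace_of E (upto i) * subspace_of E (after i) =>
      paste t.1 t.2 j) = (fun t => t.1 (exist _ j h)).
    by apply/funext => t; rewrite (paste_upto _ _ h).
  by apply: (measurableT_comp (measurable_coord _)); exact: measurable_fst.
have -> : (fun t : subspace_of E (upto i) * subspace_of E (after i) =>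
      paste t.1 t.2 j) = (fun t => t.2 (exist _ j h)).
    by apply/funext => t; rewrite (paste_after _ _ h).
by apply: (measurableT_comp (measurable_coord _)); exact: measurable_snd.
Qed.

Lemma restr_upto_paste (i : 'I_n) (a : subspace_of E (upto i)) u :
  restr (upto i) (paste a u) = a.
Proof.
apply: functional_extensionality_dep; case=> j h.
by rewrite /restr (paste_upto _ _ h).
Qed.

Lemma restr_after_paste (i : 'I_n) (a : subspace_of E (upto i)) u :
  restr (after i) (paste a u) = u.
Proof.
apply: functional_extensionality_dep; case=> j h.
by rewrite /restr (paste_after _ _ h).
Qed.

(** Serves twice: to say without null sets that a law freezes the coordinates below [k], and to
    interpolate between two configurations one coordinate at a time. *)
Definition mix (k : nat) (x y : prodspace E) : prodspace E :=
  fun j => if (j < k)%N then x j else y j.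

Lemma measurable_mix k x : measurable_fun [set: prodspace E] (mix k x).
Proof.
apply: measurable_fun_prodspace => j; rewrite /mix.
by case: (j < k)%N; [exact: measurable_cst | exact: measurable_coord].
Qed.

Definition agree_below (k : nat) (x y : prodspace E) : Prop :=
  forall j : 'I_n, (j < k)%N -> x j = y j.

Lemma agree_below_mix k x y : agree_below k x (mix k x y).
Proof. by move=> j jk; rewrite /mix jk. Qed.

Lemma mix_paste (i : 'I_n) x u :
  mix i.+1 x (paste (restr (upto i) x) u) = paste (restr (upto i) x) u.
Proof.
apply: functional_extensionality_dep => j; rewrite /mix ltnS.
have [h|//] := leqP j i.
by rewrite (paste_upto _ _ h).
Qed.

Lemma agree_below_restr (i : 'I_n) x y :
  agree_below i.+1 x y -> restr (upto i) x = restr (upto i) y.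
Proof.
by move=> h; apply: functional_extensionality_dep; case=> j ji; apply: h.
Qed.

(** Every coordinate map factors through one of the two restrictions. The rectangles are the sets on
    which [regular_cond_law] speaks, so they have to generate for uniqueness of measures to
    apply. *)
Lemma measurable_prodspace_rect (i : 'I_n) :
  measurable = <<s [set C | exists A B, [/\ measurable A, measurable B &
      C = (restr (upto i) @^-1` A) `&` (restr (after i) @^-1` B) ]] >>
  :> set (set (prodspace E)).
Proof.
apply/seteqP; split.
  apply: smallest_sub; first exact: smallest_sigma_algebra.
  move=> _ [j _ [A mA <-]]; apply: sub_sigma_algebra.
  have [h|h] := leqP j i.
    exists ((fun a : subspace_of E (upto i) => a (exist _ j h)) @^-1` A), setT.
    split => //; last by rewrite preimage_setT setIT setTI.
    by rewrite -[X in measurable X]setTI; exact: measurable_coord.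
  exists setT, ((fun a : subspace_of E (after i) => a (exist _ j h)) @^-1` A).
  split => //.
  by rewrite -[X in measurable X]setTI; exact: measurable_coord.
apply: smallest_sub; first exact: sigma_algebra_measurable.
move=> _ [A [B [mA mB ->]]]; apply: measurableI.
  by rewrite -[X in measurable X]setTI; exact: measurable_restr.
by rewrite -[X in measurable X]setTI; exact: measurable_restr.
Qed.

End splitting.

(** * Conditional laws as laws of whole configurations *)

Section conditional_law.
Context {R : realType} {n : nat} {E : 'I_n -> ptopologicalType} (i : 'I_n)
  (kappa : R.-pker (subspace_of E (upto i)) ~> (subspace_of E (after i))).

Lemma measurable_paste_restr (x : prodspace E) :
  measurable_fun [set: subspace_of E (after i)] (paste (restr (upto i) x)).
Proof.
have m := measurable_fun_pair2 (restr (upto i) x) (@measurable_paste n E i).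
exact: m.
Qed.

(** The initial segment is frozen at that of [x] and the rest is drawn from [kappa]. Transporting
    the law to the full space puts all levels of conditioning on one space. *)
Definition condlaw (x : prodspace E) : {measure set (prodspace E) -> \bar R} :=
  measure_function_pushforward__canonical__measure_function_Measure
    (kappa (restr (upto i) x)) (measurable_paste_restr x).

Lemma condlaw_setT x : condlaw x setT = 1.
Proof.
transitivity (kappa (restr (upto i) x) setT); last exact: prob_kernel.
by rewrite /condlaw /= /pushforward preimage_setT.
Qed.

Lemma integral_condlaw x (F : prodspace E -> \bar R) :
  (forall y, 0 <= F y) -> measurable_fun setT F ->
  \int[condlaw x]_y F y =
  \int[kappa (restr (upto i) x)]_u F (paste (restr (upto i) x) u).
Proof.
move=> F0 mF; rewrite ge0_integral_pushforward ?preimage_setT//.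
exact: measurable_paste_restr.
Qed.

(** Both the kernel and the set it measures vary with [x]; the latter is a section of the fixed
    measurable set [W]. *)
Lemma measurable_condlaw U : measurable U ->
  measurable_fun [set: prodspace E] (condlaw ^~ U).
Proof.
move=> mU.
pose W := (fun p : subspace_of E (upto i) * subspace_of E (after i) =>
  paste p.1 p.2) @^-1` U.
have mW : measurable W.
  by rewrite -[X in measurable X]setTI; exact: measurable_paste.
have -> : condlaw ^~ U =
    (fun a => kappa a (xsection W a)) \o restr (upto i).
  apply/funext => x; congr (kappa _ _).
  by apply/seteqP; split => u; rewrite /xsection/= in_setE.
apply: measurableT_comp; last exact: measurable_restr.
by apply: measurable_fun_xsection_finite_kernel; rewrite inE.
Qed.

(* The dummy [unit] turns [mu] and [condlaw] into composable kernels. *)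
Let kcl (z : unit * prodspace E) : {measure set (prodspace E) -> \bar R} :=
  condlaw z.2.

Let measurable_kcl U : measurable U -> measurable_fun setT (kcl ^~ U).
Proof.
move=> mU; apply: (measurableT_comp (measurable_condlaw mU)).
exact: measurable_snd.
Qed.

HB.instance Definition _ := isKernel.Build _ _ _ _ R kcl measurable_kcl.

Let kcl_prob z : kcl z setT = 1.
Proof. exact: condlaw_setT. Qed.

HB.instance Definition _ := Kernel_isProbability.Build _ _ _ _ R kcl kcl_prob.

Context (mu : probability (prodspace E) R).
Hypothesis kappaP : regular_cond_law mu kappa.

Let kmu : unit -> {measure set (prodspace E) -> \bar R} :=
  kprobability (measurable_cst (mu : pprobability _ R)).

HB.instance Definition _ := ProbabilityKernel.copy kmu
  (kprobability (measurable_cst (mu : pprobability _ R))).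

(** On a rectangle, pasting keeps the initial segment, so the inner measure is [kappa] of the second
    side when [x] lies over the first side and 0 otherwise: this is the defining identity of
    [kappa]. Rectangles form a pi-system, and uniqueness of finite measures does the rest. *)
Let kcompE A : measurable A -> kcomp kmu kcl tt A = mu A.
Proof.
apply: (measure_unique _ (fun=> setT) (measurable_prodspace_rect i)).
- move=> _ _ [A1 [B1 [mA1 mB1 ->]]] [A2 [B2 [mA2 mB2 ->]]].
  exists (A1 `&` A2), (B1 `&` B2).
  split; [exact: measurableI|exact: measurableI|].
  by rewrite !preimage_setI setIACA.
- by move=> _; exists setT, setT; rewrite !preimage_setT setIT; split.
- by rewrite bigcup_const.
- move=> _ [A1 [B1 [mA1 mB1 ->]]].
  apply/esym/(etrans (kappaP mA1 mB1))/esym.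
  rewrite /= /kcomp.
  rewrite [RHS]integral_mkcond; apply: eq_integral => x _.
  rewrite /kcl /condlaw/= /pushforward patchE.
  case: ifPn => [|] xA; move: xA; rewrite ?inE ?notin_setE /= => xA.
    congr (kappa _ _); apply/seteqP; split => u /=.
      by rewrite restr_after_paste => -[].
    by rewrite restr_upto_paste restr_after_paste.
  rewrite (_ : _ @^-1` _ = set0) ?measure0//.
  by apply/seteqP; split => u //=; rewrite restr_upto_paste => -[].
- move=> _; rewrite [X in X < _](_ : _ = \int[mu]_y 1)//.
    rewrite integral_cst// mul1e [X in X < _](_ : _ = 1) ?ltry//.
    exact: probability_setT.
  by apply: eq_integral => y _; exact: condlaw_setT.
Qed.

Lemma integral_condlawK (F : prodspace E -> \bar R) :
  (forall y, 0 <= F y) -> measurable_fun setT F ->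
  \int[mu]_x \int[condlaw x]_y F y = \int[mu]_x F x.
Proof.
move=> F0 mF.
have <- := @integral_kcomp _ _ _ _ _ _ R kmu kcl tt F F0 mF.
apply: eq_measure_integral => A mA _; exact: kcompE.
Qed.

End conditional_law.

(** * Exponential moments along the levels of conditioning *)

Section bounded_differences.
Context {R : realType} {n : nat} {E : 'I_n -> ptopologicalType}
  (mu : probability (prodspace E) R).
Notation XX := (prodspace E).

(* [K x] is the law of the whole configuration given its coordinates [j < k],
   when these are those of [x]. *)
Record cond_version (k : nat) (K : XX -> {measure set XX -> \bar R}) : Prop := {
  cv_mass : forall x, K x setT = 1;
  cv_meas : forall F : XX -> \bar R, (forall y, 0 <= F y) ->
    measurable_fun [set: XX] F ->
    measurable_fun [set: XX] (fun x => \int[K x]_y F y);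
  cv_int : forall F : XX -> \bar R, (forall y, 0 <= F y) ->
    measurable_fun [set: XX] F -> \int[mu]_x \int[K x]_y F y = \int[mu]_x F x;
  cv_mix : forall (F : XX -> \bar R) x, (forall y, 0 <= F y) ->
    measurable_fun [set: XX] F -> \int[K x]_y F y = \int[K x]_y F (mix k x y);
  cv_local : forall (F : XX -> \bar R) x z, agree_below k x z ->
    \int[K x]_y F y = \int[K z]_y F y }.

Definition cexp (K : XX -> {measure set XX -> \bar R}) (f : XX -> R) (x : XX) :
    R :=
  fine (\int[K x]_y (f y)%:E).

Definition below_local (k : nat) (w : XX -> R) : Prop :=
  forall x z, agree_below k x z -> w x = w z.

Section one_level.
Context {k : nat} {K : XX -> {measure set XX -> \bar R}}
  (cK : cond_version k K).

Lemma cexp_local f : below_local k (cexp K f).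
Proof. by move=> x z xz; rewrite /cexp (cv_local cK _ xz). Qed.

Section bounded.
Context {f : XX -> R} {M : R} (mf : measurable_fun [set: XX] f)
  (f_bnd : forall x, (0 <= f x <= M)%R).

Let f0 x : 0 <= (f x)%:E.
Proof. by rewrite lee_fin; have /andP[] := f_bnd x. Qed.

Let mEf : measurable_fun [set: XX] (fun x => (f x)%:E).
Proof. exact/measurable_EFinP. Qed.

Lemma cexpE x : (cexp K f x)%:E = \int[K x]_y (f y)%:E.
Proof. by rewrite /cexp -(integral_fin_of_bounds (cv_mass cK x) mf f_bnd). Qed.

Lemma cexp_bounds x : (0 <= cexp K f x <= M)%R.
Proof.
rewrite -!lee_fin cexpE integral_ge0//=.
apply: (@le_trans _ _ (\int[K x]_y M%:E)); last first.
  by rewrite integral_cst// (cv_mass cK) mule1.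
apply: ge0_le_integral => // y _.
by rewrite lee_fin; have /andP[] := f_bnd y.
Qed.

Lemma measurable_cexp : measurable_fun [set: XX] (cexp K f).
Proof.
apply/measurable_EFinP; rewrite (_ : _ \o _ = fun x => \int[K x]_y (f y)%:E).
  exact: (cv_meas cK).
by apply/funext => x /=; rewrite cexpE.
Qed.

(** Under [K x] the weight is the constant [w x], since [cv_mix] freezes the coordinates it depends
    on; it leaves the inner integral, and [cv_int] removes the conditioning. *)
Lemma integral_local_cexp (w : XX -> R) :
  measurable_fun [set: XX] w -> (forall x, 0 <= w x)%R -> below_local k w ->
  \int[mu]_x (w x * cexp K f x)%:E = \int[mu]_x (w x * f x)%:E.
Proof.
move=> mw w0 lw.
have mwf : measurable_fun [set: XX] (fun x => (w x * f x)%:E).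
  by apply/measurable_EFinP; exact: measurable_funM.
have wf0 x : 0 <= (w x * f x)%:E by rewrite lee_fin mulr_ge0// -lee_fin.
rewrite -[RHS](cv_int cK)//; apply: eq_integral => x _.
rewrite (cv_mix cK)// EFinM cexpE (@cv_mix _ _ cK (fun y => (f y)%:E))//.
have lwm y : w (mix k x y) = w x by apply/esym/lw; exact: agree_below_mix.
under [RHS]eq_integral do rewrite lwm EFinM.
rewrite ge0_integralZl_EFin//.
by apply: (measurableT_comp mEf); exact: measurable_mix.
Qed.

End bounded.
End one_level.

Section two_levels.
Context {k : nat} {K K' : XX -> {measure set XX -> \bar R}}
  (cK : cond_version k K) (cK' : cond_version k.+1 K').
Context {f : XX -> R} {M : R} (mf : measurable_fun [set: XX] f)
  (f_bnd : forall x, (0 <= f x <= M)%R).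
Context {c : R} (osc : forall x z,
  (forall j : 'I_n, j != k :> nat -> x j = z j) ->
  (cexp K' f x <= cexp K' f z + c)%R).
Context {l : R} (l0 : (0 <= l)%R).

Let g := cexp K' f.
Let h := cexp K g.
Let G := cexp K f.

Let mg : measurable_fun [set: XX] g.
Proof. exact: (measurable_cexp cK' mf f_bnd). Qed.
Let g_bnd x : (0 <= g x <= M)%R. Proof. exact: (cexp_bounds cK' mf f_bnd). Qed.
Let mh : measurable_fun [set: XX] h.
Proof. exact: (measurable_cexp cK mg g_bnd). Qed.
Let h_bnd x : (0 <= h x <= M)%R. Proof. exact: (cexp_bounds cK mg g_bnd). Qed.
Let mG : measurable_fun [set: XX] G.
Proof. exact: (measurable_cexp cK mf f_bnd). Qed.
Let G_bnd x : (0 <= G x <= M)%R. Proof. exact: (cexp_bounds cK mf f_bnd). Qed.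

Let mexp (u : XX -> R) : measurable_fun [set: XX] u ->
  measurable_fun [set: XX] (fun x => expR (l * u x)).
Proof. by move=> u_; apply: measurableT_comp => //; exact: measurable_funM. Qed.

(** Hoeffding's lemma for [g (mix k x y)] as a function of [y]: coordinates below [k] are frozen and
    [g] ignores those beyond [k], so only the coordinate [k] moves the value. *)
Lemma mgf_conditional_step x :
  \int[K x]_y (expR (l * g y))%:E <=
  (expR (l ^+ 2 * c ^+ 2 / 8))%:E * (expR (l * h x))%:E.
Proof.
have mgx : measurable_fun [set: XX] (fun y => g (mix k x y)).
  by apply: (measurableT_comp mg); exact: measurable_mix.
rewrite (cv_mix cK); last 2 first.
- by move=> y; rewrite lee_fin expR_ge0.
- by apply/measurable_EFinP; exact: mexp.
apply: le_trans (hoeffding_mgf (cv_mass cK x) mgx _ _ l0) _.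
- by move=> y; have /andP[] := g_bnd (mix k x y).
(* [z] has the same [g] as [mix k x y'], but differs from [mix k x y] at the coordinate [k] only, as
   [osc] requires. *)
- move=> y y'; pose z := mix k.+1 (mix k x y') (mix k x y).
  have -> : g (mix k x y') = g z.
    by apply: (cexp_local cK'); exact: agree_below_mix.
  apply: osc => j jk; rewrite /z /mix ltnS (leq_eqVlt j k) (negbTE jk)/=.
  by case: (j < k)%N.
- rewrite -EFinM -expRD addrC lee_fin ler_expR /h /cexp.
  rewrite [in leRHS](cv_mix cK)//.
  + by move=> y; rewrite lee_fin; have /andP[] := g_bnd y.
  + exact/measurable_EFinP.
Qed.

(* [h] and [G] are two versions of the same conditional expectation; comparing
   their exponential moments spares a proof that they agree almost surely. *)
Lemma mgf_tower :
  \int[mu]_x (expR (l * h x))%:E <= \int[mu]_x (expR (l * G x))%:E.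
Proof.
pose w x := (l * expR (l * h x))%R.
have w0 x : (0 <= w x)%R by rewrite /w mulr_ge0 ?expR_ge0.
have mw : measurable_fun [set: XX] w.
  by apply: measurable_funM => //; exact: mexp.
have lw : below_local k w.
  by move=> x z xz; rewrite /w /h (cexp_local cK _ xz).
have lw' : below_local k.+1 w.
  by move=> x z xz; apply: lw => j jk; apply: xz; rewrite ltnS ltnW.
apply: (mgf_le_of_tangent (probability_setT mu) mh mG h_bnd G_bnd l0).
apply: (etrans (integral_local_cexp cK mg g_bnd mw w0 lw)).
apply: (etrans (integral_local_cexp cK' mf f_bnd mw w0 lw')).
exact/esym/(integral_local_cexp cK mf f_bnd mw w0 lw).
Qed.

(** The factor in the conditional bound is deterministic, so the bound integrates against [mu];
    [mgf_tower] then trades [h], the average of [g], for [G], the version given at level [k]. *)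
Lemma mgf_step :
  \int[mu]_x (expR (l * g x))%:E <=
  (expR (l ^+ 2 * c ^+ 2 / 8))%:E * \int[mu]_x (expR (l * G x))%:E.
Proof.
have m1 : measurable_fun [set: XX] (fun x => (expR (l * h x))%:E).
  by apply/measurable_EFinP; exact: mexp.
have m2 : measurable_fun [set: XX] (fun x => (expR (l * g x))%:E).
  by apply/measurable_EFinP; exact: mexp.
have e0 (u : XX -> R) x : 0 <= (expR (l * u x))%:E by rewrite lee_fin expR_ge0.
apply: (@le_trans _ _
  ((expR (l ^+ 2 * c ^+ 2 / 8))%:E * \int[mu]_x (expR (l * h x))%:E)).
  rewrite -ge0_integralZl_EFin ?expR_ge0// -(cv_int cK)//.
  apply: ge0_le_integral => //.
  - by move=> x _; exact: integral_ge0.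
  - exact: (cv_meas cK).
  - exact: measurable_funeM.
  - by move=> x _; exact: mgf_conditional_step.
by apply: lee_wpmul2l; [rewrite lee_fin expR_ge0 | exact: mgf_tower].
Qed.

End two_levels.

Section all_levels.
Context {K : nat -> XX -> {measure set XX -> \bar R}} {c : nat -> R}
  (cK : forall k, (k <= n)%N -> cond_version k (K k)).
Context {f : XX -> R} {M : R} (mf : measurable_fun [set: XX] f)
  (f_bnd : forall x, (0 <= f x <= M)%R).
Context (osc : forall k, (k < n)%N -> forall x z : XX,
  (forall j : 'I_n, j != k :> nat -> x j = z j) ->
  (cexp (K k.+1) f x <= cexp (K k.+1) f z + c k)%R).

Let e := fine (\int[mu]_x (f x)%:E).
Let S := (\sum_(k < n) c k ^+ 2)%R.

Lemma mgf_le l : (0 <= l)%R ->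
  \int[mu]_x (expR (l * f x))%:E <= (expR (l * e + l ^+ 2 * S / 8))%:E.
Proof.
move=> l0.
have chain m : (m <= n)%N -> \int[mu]_x (expR (l * cexp (K m) f x))%:E <=
    (expR (l * e + l ^+ 2 * (\sum_(k < m) c k ^+ 2) / 8))%:E.
  elim: m => [_|m IH mn].
    rewrite big_ord0 mulr0 mul0r addr0.
    (* Agreement below 0 is vacuous, so the level 0 integral does not depend on the point, and its
       [mu]-average is [e]. *)
    have c0 : cexp (K 0) f = cst e.
      apply/funext => x.
      rewrite /e -(cv_int (cK (leq0n _)))//; last exact/measurable_EFinP.
        rewrite (_ : \int[mu]_z _ = \int[mu]_z (\int[K 0%N x]_y (f y)%:E)).
          by rewrite (integral_cst_mass1 (probability_setT mu)).
        by apply: eq_integral => z _; exact: (cv_local (cK (leq0n _))).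
      by move=> y; rewrite lee_fin; have /andP[] := f_bnd y.
    rewrite c0 le_eqVlt; apply/orP; left; apply/eqP.
    exact: (integral_cst_mass1 (probability_setT mu) (expR (l * e))%:E).
  rewrite big_ord_recr/=.
  apply: (le_trans (mgf_step (cK (ltnW mn)) (cK mn) mf f_bnd (osc mn) l0)).
  apply: (le_trans (lee_wpmul2l _ (IH (ltnW mn)))).
    by rewrite lee_fin expR_ge0.
  rewrite -EFinM -expRD lee_fin ler_expR le_eqVlt; apply/orP; left; apply/eqP.
  by move: (\sum_(_ < _) _)%R => s; ring.
have := chain n (leqnn n).
(* At level [n] all coordinates are frozen, so the conditional expectation is [f] itself,
   everywhere. *)
under eq_integral => x _.
  rewrite /cexp (cv_mix (cK (leqnn n))); last 2 first.
  - by move=> y; rewrite lee_fin; have /andP[] := f_bnd y.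
  - exact/measurable_EFinP.
  under eq_integral => y _.
    rewrite (_ : mix n x y = x); last first.
      by apply: functional_extensionality_dep => j; rewrite /mix ltn_ord.
    over.
  rewrite integral_cst// (cv_mass (cK (leqnn n))) mule1/=.
  over.
done.
Qed.

(** Markov's inequality for the exponential. [l] stays free because for [S = 0] and [t > 0] there is
    no optimal value. *)
Lemma upper_tail_exp (t l : R) : (0 <= l)%R ->
  mu [set x | (t <= f x - e)%R] <= (expR (l ^+ 2 * S / 8 - l * t))%:E.
Proof.
move=> l0; set A := [set x | _].
have mA : measurable A.
  by apply: measurable_superlevel; exact: measurable_funB.
rewrite -[X in mu X]setIT -integral_indic//.
apply: (@le_trans _ _
  (\int[mu]_x ((expR (- (l * (e + t))))%:E * (expR (l * f x))%:E))).
  have mexp : measurable_fun [set: XX] (fun x => (expR (l * f x))%:E).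
    apply/measurable_EFinP; apply: measurableT_comp => //.
    exact: measurable_funM.
  apply: ge0_le_integral => //.
  - by apply/measurable_EFinP; exact: measurable_indic.
  - exact: measurable_funeM.
  - move=> x _; rewrite -EFinM lee_fin -expRD indicE.
    have [xA|xA] := boolP (x \in A); last by rewrite expR_ge0.
    move: xA; rewrite inE /A/= => xA.
    apply: (le_trans _ (expR_ge1Dx _)); rewrite lerDl.
    rewrite addrC -mulrBr mulr_ge0//; lra.
rewrite ge0_integralZl_EFin ?expR_ge0//; last first.
  apply/measurable_EFinP; apply: measurableT_comp => //.
  exact: measurable_funM.
apply: (le_trans (lee_wpmul2l _ (mgf_le l0))).
  by rewrite lee_fin expR_ge0.
rewrite -EFinM -expRD lee_fin ler_expR le_eqVlt; apply/orP; left; apply/eqP.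
ring.
Qed.

Lemma upper_tail (t : R) : (0 <= t)%R ->
  mu [set x | (t <= f x - e)%R] <= expeR (- ((2 * t ^+ 2)%:E / S%:E)).
Proof.
move=> t0.
have S0 : (0 <= S)%R by apply: sumr_ge0 => k _; exact: sqr_ge0.
have [Sz|Sn0] := eqVneq S 0%R; last first.
  have Sp : (0 < S)%R by rewrite lt_neqAle eq_sym Sn0.
  rewrite inver (negbTE Sn0) -EFinM -EFinN/=.
  apply: (le_trans (@upper_tail_exp t (4 * t / S) _)).
    by rewrite divr_ge0// mulr_ge0.
  rewrite lee_fin ler_expR le_eqVlt; apply/orP; left; apply/eqP.
  by field.
(* For [S = 0] and [t = 0] the exponent is 0 and [l = 0] gives the bound 1. *)
have [->|tn0] := eqVneq t 0%R.
  apply: (le_trans (upper_tail_exp 0 (lexx 0))).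
  by rewrite expr0n/= !mulr0 mul0e oppe0/= !mul0r subr0.
have tp : (0 < t)%R by rewrite lt_neqAle eq_sym tn0.
rewrite Sz inver eqxx.
have -> : (2 * t ^+ 2)%:E * +oo = +oo :> \bar R.
  by rewrite gt0_muley// lte_fin mulr_gt0// exprn_gt0.
(* The right-hand side is 0. The choice [l = (d * t)^-1] bounds the probability by [expR (- d^-1)],
   which is at most [d]. *)
rewrite /=; apply/lee_addgt0Pr => d d0; rewrite add0e.
apply: (le_trans (@upper_tail_exp t (d * t)^-1 _)).
  by rewrite invr_ge0 mulr_ge0// ltW.
rewrite Sz mulr0 mul0r sub0r lee_fin invfM mulfVK// expRN.
rewrite -[leRHS]invrK lef_pV2 ?posrE ?expR_gt0 ?invr_gt0//.
by apply: le_trans (expR_ge1Dx _); rewrite lerDr.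
Qed.

End all_levels.
End bounded_differences.

(** * The levels given by [mu] and by the conditional laws *)

Section versions.
Context {R : realType} {n : nat} {E : 'I_n -> ptopologicalType}
  (mu : probability (prodspace E) R).

Lemma cond_version_cst : cond_version mu 0 (fun=> mu).
Proof.
split.
- by move=> x; exact: probability_setT.
- by move=> F F0 mF; exact: measurable_cst.
- by move=> F F0 mF; exact: (integral_cst_mass1 (probability_setT mu)).
- by [].
- by [].
Qed.

(** The index shifts by one: conditioning on the coordinates up to and including [i] fixes those
    below [i.+1]. Level 0 is not reached this way, and is [mu] itself. *)
Lemma cond_version_condlaw (i : 'I_n)
    (kappa : R.-pker (subspace_of E (upto i)) ~> (subspace_of E (after i))) :
  regular_cond_law mu kappa -> cond_version mu i.+1 (condlaw kappa).
Proof.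
move=> kappaP; split.
- exact: condlaw_setT.
- move=> F F0 mF; apply: measurable_fun_integral_kernel => // U mU.
  exact: measurable_condlaw.
- by move=> F F0 mF; exact: integral_condlawK.
- move=> F x F0 mF; rewrite !integral_condlaw//.
    by under [RHS]eq_integral do rewrite mix_paste.
  by apply: (measurableT_comp mF); exact: measurable_mix.
- move=> F x z xz; apply: eq_measure_integral => A mA _.
  by rewrite /condlaw/= (agree_below_restr xz).
Qed.

End versions.

(** * Integrals against a coupling *)

Section coupling.
Context {R : realType} d (T : measurableType d) (P : probability (T * T)%type R)
  (m1 m2 : {measure set T -> \bar R}) (Pm : is_coupling P m1 m2).
Context (F : T -> \bar R) (F0 : forall u, 0 <= F u)
  (mF : measurable_fun [set: T] F).

Lemma integral_coupling_fst : \int[m1]_u F u = \int[P]_p F p.1.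
Proof.
have -> : \int[P]_p F p.1 = \int[pushforward P fst]_u F u.
  by rewrite (ge0_integral_pushforward measurable_fst P measurableT mF).
apply: eq_measure_integral => A mA _.
by rewrite /= /pushforward Pm.1.
Qed.

Lemma integral_coupling_snd : \int[m2]_u F u = \int[P]_p F p.2.
Proof.
have -> : \int[P]_p F p.2 = \int[pushforward P snd]_u F u.
  by rewrite (ge0_integral_pushforward measurable_snd P measurableT mF).
apply: eq_measure_integral => A mA _.
by rewrite /= /pushforward Pm.2.
Qed.

End coupling.

(** Extension by a default value: inductions over levels run on natural numbers, the data on
    ordinals. *)
Definition ordfun {R : Type} (x0 : R) {n : nat} (F : 'I_n -> R) (k : nat) : R :=
  oapp F x0 (insub k).

Lemma ordfunE {R : Type} (x0 : R) {n : nat} (F : 'I_n -> R) (i : 'I_n) :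
  ordfun x0 F i = F i.
Proof. by rewrite /ordfun valK. Qed.

(** * Diameters and local oscillations *)

Section oscillation.
Context {R : realType} {n : nat} {E : 'I_n -> ptopologicalType}.
Variable rho : forall i : 'I_n, E i -> E i -> R.
Hypothesis rho_metric : forall i, is_metric (@rho i).
Notation XX := (prodspace E).

Let rho_ge0 i (x y : E i) : (0 <= rho x y)%R.
Proof. by have [] := rho_metric i. Qed.

Let rho_xx i (x : E i) : rho x x = 0%R.
Proof. by have [_ r0 _ _] := rho_metric i; apply/r0. Qed.

Lemma le_diam i (x y : E i) : (rho x y)%:E <= diam rho i.
Proof. by apply: ereal_sup_ubound; exists (x, y). Qed.

Lemma diam_ge0 i : 0 <= diam rho i.
Proof. by apply: le_trans (le_diam (point : E i) point); rewrite rho_xx. Qed.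

Lemma agree_off_eq i (x z : XX) : agree_off i x z -> x i = z i -> x = z.
Proof.
move=> xz xzi; apply: functional_extensionality_dep => j.
by have [->//|ji] := eqVneq j i; exact: xz.
Qed.

Lemma le_local_osc (f : XX -> R) i (x z : XX) : agree_off i x z ->
  (`|f x - f z| / rho (x i) (z i))%:E <= local_osc rho f i.
Proof. by move=> xz; apply: ereal_sup_ubound; exists (x, z). Qed.

Lemma local_osc_ge0 (f : XX -> R) i : 0 <= local_osc rho f i.
Proof.
apply: le_trans (@le_local_osc f i point point _); last by [].
by rewrite subrr normr0 mul0r.
Qed.

(** When [x] and [z] differ at [i] only, [rho_sum] reduces to its term at [i]. [L] carries no sign
    condition, hence the absolute value. *)
Lemma local_osc_fin (f : XX -> R) i : lipschitz_rho rho f ->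
  local_osc rho f i \is a fin_num.
Proof.
move=> [L fL]; rewrite ge0_fin_numE ?local_osc_ge0//.
apply: (@le_lt_trans _ _ `|L|%:E); last exact: ltry.
apply: ge_ereal_sup => _ [[x z]/= xz <-]; rewrite lee_fin.
have [xzi|xzi] := eqVneq (rho (x i) (z i)) 0%R.
  by rewrite xzi invr0 mulr0.
have rp : (0 < rho (x i) (z i))%R by rewrite lt_neqAle eq_sym xzi rho_ge0.
rewrite ler_pdivrMr//; apply: (le_trans (fL x z)).
rewrite /rho_sum (bigD1 i)//= big1 ?addr0; first by rewrite ler_pM2r// ler_norm.
by move=> j ji; rewrite (xz _ ji).
Qed.

Lemma local_osc_lip (f : XX -> R) i (x z : XX) : lipschitz_rho rho f ->
  agree_off i x z ->
  (`|f x - f z| <= fine (local_osc rho f i) * rho (x i) (z i))%R.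
Proof.
(* At distance 0 the quotient is 0 by convention and says nothing about [f]; separation of points
   gives [x = z] instead. *)
move=> lipf xz; have [xzi|xzi] := eqVneq (rho (x i) (z i)) 0%R.
  have [_ r0 _ _] := rho_metric i.
  rewrite (agree_off_eq xz) ?subrr ?normr0; last exact/r0.
  by rewrite mulr_ge0 ?fine_ge0 ?local_osc_ge0.
have rp : (0 < rho (x i) (z i))%R by rewrite lt_neqAle eq_sym xzi rho_ge0.
rewrite -ler_pdivrMr// -lee_fin fineK ?local_osc_fin//; exact: le_local_osc.
Qed.

(** Telescoping along [mix m z x], which is [x] for [m = 0] and [z] for [m = n]; consecutive terms
    differ at most at the coordinate [m]. *)
Lemma sum_of_coordinate_osc (f : XX -> R) (D : 'I_n -> R) :
  (forall i x z, agree_off i x z -> `|f x - f z| <= D i * rho (x i) (z i))%R ->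
  forall x z, (`|f x - f z| <= \sum_i D i * rho (x i) (z i))%R.
Proof.
move=> fD x z.
pose s := ordfun 0%R (fun i => D i * rho (x i) (z i))%R.
have tele m : (m <= n)%N -> (`|f x - f (mix m z x)| <= \sum_(k < m) s k)%R.
  elim: m => [_|m IH mn].
    by rewrite big_ord0 (_ : mix 0 z x = x) ?subrr ?normr0.
  rewrite big_ord_recr/=.
  have -> : (f x - f (mix m.+1 z x) = (f x - f (mix m z x)) +
      (f (mix m z x) - f (mix m.+1 z x)))%R by rewrite addrA subrK.
  apply: (le_trans (ler_normD _ _)); apply: lerD; first exact: IH (ltnW mn).
  pose i := Ordinal mn.
  rewrite -[m in s m]/(nat_of_ord i) /s ordfunE.
  have -> : x i = mix m z x i by rewrite /mix ltnn.
  have -> : z i = mix m.+1 z x i by rewrite /mix ltnSn.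
  apply: fD => j ji; rewrite /mix ltnS (leq_eqVlt j m).
  by have /negbTE-> : j != m :> nat.
have := tele n (leqnn n).
have -> : mix n z x = z.
  by apply: functional_extensionality_dep => j; rewrite /mix ltn_ord.
by under eq_bigr do rewrite /s ordfunE.
Qed.

End oscillation.

(** * Range of a conditional expectation in its last coordinate *)

Section coupling_bound.
Context {R : realType} {n : nat} {E : 'I_n -> ptopologicalType}.
Variable rho : forall i : 'I_n, E i -> E i -> R.
Hypothesis rho_metric : forall i, is_metric (@rho i).
Hypothesis rho_meas : forall i, measurable_fun [set: borel (E i) * borel (E i)]
     (fun p : borel (E i) * borel (E i) => rho p.1 p.2).
Notation XX := (prodspace E).
Variable P : forall i : 'I_n, XX -> XX ->
  probability (subspace_of E (after i) * subspace_of E (after i))%type R.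

Let rho_ge0 i (x y : E i) : (0 <= rho x y)%R.
Proof. by have [] := rho_metric i. Qed.

Let rho_xx i (x : E i) : rho x x = 0%R.
Proof. by have [_ r0 _ _] := rho_metric i; apply/r0. Qed.

Lemma measurable_rho d (T : measurableType d) (a b : T -> XX) j :
  measurable_fun [set: T] a -> measurable_fun [set: T] b ->
  measurable_fun [set: T] (fun t => rho (a t j) (b t j)).
Proof.
move=> ma mb.
have mab : measurable_fun [set: T]
    (fun t => (a t j : borel (E j), b t j : borel (E j))).
  apply: measurable_fun_pair.
    exact: (measurableT_comp (measurable_coord j) ma).
  exact: (measurableT_comp (measurable_coord j) mb).
have m := measurableT_comp (@rho_meas j) mab.
exact: m.
Qed.

Lemma Vmx_gt (i j : 'I_n) : (j < i)%N -> Vmx rho P i j = 0.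
Proof. by rewrite /Vmx; case: ltngtP. Qed.

Lemma Vmx_eq (i : 'I_n) : Vmx rho P i i = 1.
Proof.
by rewrite /Vmx; case: ltngtP => // h; exfalso; move: h; rewrite ltnn.
Qed.

Lemma Vmx_lt (i j : 'I_n) (h : after i j) : Vmx rho P i j =
  sup_nneg [set coupling_cost rho P h p.1 p.2 / (rho (p.1 i) (p.2 i))%:E
           | p in [set p | agree_off i p.1 p.2 /\ p.1 i <> p.2 i]].
Proof.
rewrite /Vmx; case: ltngtP => h'.
- by rewrite (bool_irrelevance h h').
- by exfalso; move: (h); rewrite /after ltnNge ltnW.
- by exfalso; move: (h); rewrite /after h' ltnn.
Qed.

Lemma Vmx_ge0 (i j : 'I_n) : 0 <= Vmx rho P i j.
Proof.
have [h|h|/ord_inj ->] := ltngtP i j; last by rewrite Vmx_eq.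
- by rewrite (Vmx_lt h); apply: ereal_sup_ubound; left.
- by rewrite Vmx_gt.
Qed.

Lemma Gamma_ge0 (i j : 'I_n) : 0 <= Gamma rho P i j.
Proof. by rewrite mule_ge0 ?Vmx_ge0 ?diam_ge0. Qed.

(** The three cases of [Vmx]: before [i] the pasted configurations agree; at [i] they are at the
    fixed distance [rho (x i) (z i)], at most the diameter; after [i] the integral is the coupling
    cost, at most that distance times the supremum. *)
Lemma coupled_dist_le_Gamma (i j : 'I_n) (x z : XX) :
  agree_off i x z -> x i <> z i ->
  \int[P i x z]_p (rho (paste (restr (upto i) x) p.1 j)
                       (paste (restr (upto i) z) p.2 j))%:E <= Gamma rho P i j.
Proof.
move=> xz xzi; rewrite /Gamma.
have cst_case : (j <= i)%N ->
    \int[P i x z]_p (rho (paste (restr (upto i) x) p.1 j)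
                         (paste (restr (upto i) z) p.2 j))%:E =
    (rho (x j) (z j))%:E.
  move=> h; rewrite (eq_integral (cst (rho (x j) (z j))%:E)).
    exact: (integral_cst_mass1 (probability_setT (P i x z))).
  by move=> p _; rewrite !(paste_upto _ _ h).
have [h|h|/ord_inj h] := ltngtP i j.
- have -> : \int[P i x z]_p (rho (paste (restr (upto i) x) p.1 j)
       (paste (restr (upto i) z) p.2 j))%:E = coupling_cost rho P h x z.
    by apply: eq_integral => p _; rewrite !(paste_after _ _ h).
  have rp : (0 < rho (x i) (z i))%R.
    rewrite lt_neqAle rho_ge0 andbT eq_sym; apply/eqP => r0.
    by have [_ /(_ (x i) (z i))[+ _] _ _] := rho_metric i => /(_ r0).
  apply: (@le_trans _ _ ((rho (x i) (z i))%:E * Vmx rho P i j)); last first.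
    by apply: lee_wpmul2r; [exact: Vmx_ge0|exact: le_diam].
  rewrite -lee_pdivrMl//.
  apply: (@le_trans _ _ (coupling_cost rho P h x z / (rho (x i) (z i))%:E)).
    by rewrite inver gt_eqF// muleC.
  by rewrite (Vmx_lt h); apply: ereal_sup_ubound; right; exists (x, z).
- rewrite cst_case ?(ltnW h)// Vmx_gt// mule0 (xz j) ?rho_xx//.
  by apply: contraTneq h => ->; rewrite ltnn.
- by rewrite -h in cst_case *; rewrite cst_case// Vmx_eq mule1; exact: le_diam.
Qed.

Variables (g : XX -> R) (M : R) (D : 'I_n -> R).
Hypotheses (mg : measurable_fun [set: XX] g)
  (g_bnd : forall x, (0 <= g x <= M)%R)
  (D0 : forall i, (0 <= D i)%R)
  (gD : forall i x z, agree_off i x z ->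
    (`|g x - g z| <= D i * rho (x i) (z i))%R).
Variables (i : 'I_n)
  (kappa : R.-pker (subspace_of E (upto i)) ~> (subspace_of E (after i))).
Hypothesis couplingP : forall (x z : prodspace E),
  agree_off i x z -> x i <> z i ->
  is_coupling (P i x z) (kappa (restr (upto i) x)) (kappa (restr (upto i) z)).
Variable C : R.
Hypothesis CE : C%:E = mulmv (Gamma rho P) (fun j => (D j)%:E) i.

Lemma cexp_condlaw_osc (mu : probability XX R) (x z : XX) :
  regular_cond_law mu kappa ->
  agree_off i x z ->
  (cexp (condlaw kappa) g x <= cexp (condlaw kappa) g z + C)%R.
Proof.
move=> kappaP xz; have cv := cond_version_condlaw kappaP.
have C0 : (0 <= C)%R.
  rewrite -lee_fin CE; apply: sume_ge0 => j _.
  by rewrite mule_ge0 ?Gamma_ge0// lee_fin.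
(* No coupling is provided when [x i = z i], but then [x = z]. *)
have [xzi|xzi] := pselect (x i = z i).
  by rewrite (agree_off_eq xz xzi) lerDl.
have g0 y : 0 <= (g y)%:E by rewrite lee_fin; have /andP[] := g_bnd y.
have mEg : measurable_fun [set: XX] (EFin \o g) by exact/measurable_EFinP.
have mpx := @measurable_paste_restr n E i x.
have mpz := @measurable_paste_restr n E i z.
have Pxz := couplingP xz xzi.
rewrite -lee_fin EFinD !(cexpE cv mg g_bnd) !integral_condlaw//.
rewrite (integral_coupling_fst Pxz (fun u => g0 _) (measurableT_comp mEg mpx)).
rewrite (integral_coupling_snd Pxz (fun u => g0 _) (measurableT_comp mEg mpz)).
pose a (p : subspace_of E (after i) * subspace_of E (after i)) : XX :=
  paste (restr (upto i) x) p.1.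
pose b (p : subspace_of E (after i) * subspace_of E (after i)) : XX :=
  paste (restr (upto i) z) p.2.
have ma : measurable_fun setT a by exact: (measurableT_comp mpx measurable_fst).
have mb : measurable_fun setT b by exact: (measurableT_comp mpz measurable_snd).
pose r p := (\sum_j D j * rho (a p j) (b p j))%R.
have r0 p : (0 <= r p)%R by apply: sumr_ge0 => j _; rewrite mulr_ge0.
have mDrho j : measurable_fun setT (fun p => D j * rho (a p j) (b p j))%R.
  by apply: measurable_funM => //; exact: measurable_rho.
have mr : measurable_fun setT r by apply: measurable_sum => j; exact: mDrho.
have mgb := measurableT_comp mg mb.
have mga := measurableT_comp mg ma.
(* The comparison is kept additive, so that only nonnegative functions are integrated and no
   extended reals are subtracted. *)
apply: (@le_trans _ _ (\int[P i x z]_p (g (b p) + r p)%:E)).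
  apply: ge0_le_integral => //.
  - exact/measurable_EFinP.
  - by apply/measurable_EFinP; exact: measurable_funD.
  - move=> p _; rewrite lee_fin -lerBlDl.
    by apply: le_trans (ler_norm _) (sum_of_coordinate_osc gD _ _).
have gb0 p : (0 <= g (b p))%R by have /andP[] := g_bnd (b p).
have D_eq := @ge0_integralD_real _ _ _ (P i x z) (g \o b) r mgb mr gb0 r0.
rewrite [leLHS]D_eq; apply: leeD2l; rewrite CE /mulmv.
have -> : \int[P i x z]_p (r p)%:E =
    \sum_j (D j)%:E * \int[P i x z]_p (rho (a p j) (b p j))%:E.
  under eq_integral do rewrite /r -sumEFin.
  rewrite ge0_integral_sum//; last 2 first.
  - by move=> j; exact/measurable_EFinP.
  - by move=> j p _; rewrite lee_fin mulr_ge0.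
  apply: eq_bigr => j _; under eq_integral do rewrite EFinM.
  rewrite ge0_integralZl_EFin//; first by move=> p _; rewrite lee_fin.
  by apply/measurable_EFinP; exact: measurable_rho.
apply: lee_sum => j _; rewrite muleC.
apply: lee_wpmul2r; first by rewrite lee_fin.
exact: coupled_dist_le_Gamma.
Qed.

End coupling_bound.

(** * Tail bounds under couplings *)

Section concentration.
Context {R : realType} {n : nat} {E : 'I_n -> ptopologicalType}.
Variable rho : forall i : 'I_n, E i -> E i -> R.
Hypothesis rho_metric : forall i, is_metric (@rho i).
Hypothesis rho_meas : forall i, measurable_fun [set: borel (E i) * borel (E i)]
     (fun p : borel (E i) * borel (E i) => rho p.1 p.2).
Hypothesis rho_bounded : forall i, diam rho i < +oo.
Variable mu : probability (prodspace E) R.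
Variable kappa : forall i : 'I_n,
  R.-pker (subspace_of E (upto i)) ~> (subspace_of E (after i)).
Hypothesis kappaP : forall i, regular_cond_law mu (kappa i).
Variable P : forall i : 'I_n, prodspace E -> prodspace E ->
  probability (subspace_of E (after i) * subspace_of E (after i))%type R.
Hypothesis couplingP : forall (i : 'I_n) (x z : prodspace E),
  agree_off i x z -> x i <> z i ->
  is_coupling (P i x z) (kappa i (restr (upto i) x))
                        (kappa i (restr (upto i) z)).

(** [D] need only dominate the oscillations of [g]: the same [D] will serve two functions built from
    [f]. [CE] makes the entries finite. *)
Lemma upper_tail_of_coupling (g : prodspace E -> R) (M : R) (D C : 'I_n -> R)
    (t : R) :
  measurable_fun [set: prodspace E] g -> (forall x, 0 <= g x <= M)%R ->
  (forall i, 0 <= D i)%R ->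
  (forall i x z, agree_off i x z -> `|g x - g z| <= D i * rho (x i) (z i))%R ->
  (forall i, (C i)%:E = mulmv (Gamma rho P) (fun j => (D j)%:E) i) ->
  (0 <= t)%R ->
  mu [set x | t <= g x - fine (\int[mu]_x (g x)%:E)]%R <=
    expeR (- ((2 * t ^+ 2)%:E / (\sum_i C i ^+ 2)%:E)).
Proof.
move=> mg g_bnd D0 gD CE t0.
pose K0 : prodspace E -> {measure set (prodspace E) -> \bar R} := fun=> mu.
(* Level [k'.+1] is the law conditioned through the coordinate [k']; the default of [ordfun] is
   never reached for [k <= n]. *)
pose K k :=
  if k is k'.+1 then ordfun K0 (fun i => condlaw (kappa i)) k' else K0.
have cK k : (k <= n)%N -> cond_version mu k (K k).
  case: k => [_|k kn]; first exact: cond_version_cst.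
  rewrite -[k]/(nat_of_ord (Ordinal kn)) /K ordfunE.
  exact: cond_version_condlaw.
pose c := ordfun 0%R C.
have osc k : (k < n)%N -> forall x z : prodspace E,
    (forall j : 'I_n, j != k :> nat -> x j = z j) ->
    (cexp (K k.+1) g x <= cexp (K k.+1) g z + c k)%R.
  move=> kn x z xz; rewrite -[k]/(nat_of_ord (Ordinal kn)) /K /c !ordfunE.
  apply: (cexp_condlaw_osc rho_metric rho_meas mg g_bnd D0 gD
    (@couplingP (Ordinal kn)) (CE _) (@kappaP (Ordinal kn))) => j.
  exact: xz.
have := upper_tail cK mg g_bnd osc t0.
by under eq_bigr do rewrite /c ordfunE.
Qed.

(** Finite diameters bound the distance to the fixed configuration [point]. *)
Lemma lipschitz_bounded (f : prodspace E -> R) : lipschitz_rho rho f ->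
  exists B : R, forall x, (`|f x| <= B)%R.
Proof.
move=> [L fL].
exists (`|f point| + `|L| * \sum_i fine (diam rho i))%R => x.
rewrite -[f x](subrK (f point)) addrC; apply: (le_trans (ler_normD _ _)).
rewrite lerD2l; apply: (le_trans (fL x point)).
have r0 i (a b : E i) : (0 <= rho a b)%R by have [] := rho_metric i.
have rs0 : (0 <= rho_sum rho x point)%R by apply: sumr_ge0.
apply: (le_trans (ler_wpM2r rs0 (ler_norm L))).
apply: ler_wpM2l => //; apply: ler_sum => i _.
rewrite -lee_fin fineK; first exact: le_diam.
by rewrite ge0_fin_numE ?rho_bounded// diam_ge0.
Qed.

(** Adding a constant changes neither oscillations nor deviations from the mean, and a change of
    sign exchanges the two tails; the union bound yields the factor 2. *)
Lemma two_sided_tail (f : prodspace E -> R) (C : 'I_n -> R) (t : R) :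
  measurable_fun [set: prodspace E] f -> lipschitz_rho rho f ->
  (forall i, (C i)%:E = mulmv (Gamma rho P) (local_osc rho f) i) ->
  (0 <= t)%R ->
  mu [set x | t <= `|f x - fine (\int[mu]_x (f x)%:E)|]%R <=
    2%:E * expeR (- ((2 * t ^+ 2)%:E / (\sum_i C i ^+ 2)%:E)).
Proof.
move=> mf lipf CE t0.
have [B fB] := lipschitz_bounded lipf.
pose D i := fine (local_osc rho f i).
have D0 i : (0 <= D i)%R by rewrite fine_ge0// local_osc_ge0.
have {}CE i : (C i)%:E = mulmv (Gamma rho P) (fun j => (D j)%:E) i.
  by rewrite CE; apply: eq_bigr => j _; rewrite fineK// local_osc_fin.
have fD i x z : agree_off i x z -> (`|f x - f z| <= D i * rho (x i) (z i))%R.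
  exact: local_osc_lip.
(* Both tails are upper tails of nonnegative functions. *)
pose h x := (B + f x)%R; pose h' x := (2 * B + (-1) * h x)%R.
have h_bnd x : (0 <= h x <= 2 * B)%R.
  by have := fB x; rewrite /h ler_norml => /andP[? ?]; apply/andP; split; lra.
have h'_bnd x : (0 <= h' x <= 2 * B)%R.
  by have /andP[? ?] := h_bnd x; apply/andP; rewrite /h'; split; lra.
have mh : measurable_fun [set: prodspace E] h by exact: measurable_funD.
have mh' : measurable_fun [set: prodspace E] h'.
  by apply: measurable_funD => //; exact: measurable_funM.
have int_f : fine (\int[mu]_x (f x)%:E) =
    (- B + 1 * fine (\int[mu]_x (h x)%:E))%R.
  rewrite -[RHS]/(fine _%:E).
  rewrite -(integral_affine (probability_setT mu) mh h_bnd).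
  by congr fine; apply: eq_integral => x _; rewrite /h mul1r addKr.
have int_h' : fine (\int[mu]_x (h' x)%:E) =
    (2 * B + (-1) * fine (\int[mu]_x (h x)%:E))%R.
  by rewrite (integral_affine (probability_setT mu) mh h_bnd).
set eh := fine (\int[mu]_x (h x)%:E) in int_f int_h'.
have hD i x z : agree_off i x z -> (`|h x - h z| <= D i * rho (x i) (z i))%R.
  by move=> xz; rewrite /h opprD addrACA subrr add0r; exact: fD.
have h'D i x z : agree_off i x z -> (`|h' x - h' z| <= D i * rho (x i) (z i))%R.
  move=> xz; rewrite /h' opprD addrACA subrr add0r !mulN1r -opprD normrN.
  exact: hD.
have up := @upper_tail_of_coupling h (2 * B)%R D C t mh h_bnd D0 hD CE t0.
have lo := @upper_tail_of_coupling h' (2 * B)%R D C t mh' h'_bnd D0 h'D CE t0.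
rewrite -/eh in up; rewrite int_h' in lo; rewrite int_f.
have mup : measurable [set x | t <= h x - eh]%R.
  by apply: measurable_superlevel; exact: measurable_funB.
have mlo : measurable [set x | t <= h' x - (2 * B + (-1) * eh)]%R.
  by apply: measurable_superlevel; exact: measurable_funB.
have mA : measurable [set x | t <= `|f x - (- B + 1 * eh)|]%R.
  apply: measurable_superlevel.
  by apply: measurableT_comp => //; exact: measurable_funB.
apply: (@le_trans _ _ (mu ([set x | t <= h x - eh]%R `|`
    [set x | t <= h' x - (2 * B + (-1) * eh)]%R))).
  apply: le_measure; rewrite ?inE//; first exact: measurableU.
  move=> x /=; rewrite /h' /h ler_normr => /orP[xt|xt]; [left|right]; lra.
apply: (le_trans (measureU2 _ mup mlo)).
by rewrite mule_natl mule2n; apply: leeD.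
Qed.

End concentration.

Unset Implicit Arguments.
Set Strict Implicit.
(* In the exponent, mathcomp-analysis' conventions r / +oo = 0, r / 0 = +oo for
   r > 0, and 0 / 0 = 0 are in force in \bar R, and expeR (-oo) = 0. *)
Theorem corollary5p4 (R : realType) (n : nat) (E : 'I_n -> ptopologicalType)
  (polishE : forall i, polish R (E i))
  (rho : forall i : 'I_n, E i -> E i -> R)
  (rho_metric : forall i, is_metric (rho i))
  (rho_meas : forall i, measurable_fun [set: borel (E i) * borel (E i)]
     (fun p : borel (E i) * borel (E i) => rho i p.1 p.2))
  (rho_bounded : forall i, diam rho i < +oo)
  (mu : probability (prodspace E) R)
  (dO : measure_display) (Omega : measurableType dO) (Pr : probability Omega R)
  (X : {mfun Omega >-> prodspace E})
  (lawX : forall A : set (prodspace E), measurable A ->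
     distribution Pr X A = mu A)
  (kappa : forall i : 'I_n,
     R.-pker (subspace_of E (upto i)) ~> (subspace_of E (after i)))
  (kappaP : forall i, regular_cond_law mu (kappa i))
  (P : forall i : 'I_n, prodspace E -> prodspace E ->
     probability (subspace_of E (after i) * subspace_of E (after i))%type R)
  (couplingP : forall (i : 'I_n) (x z : prodspace E),
     agree_off i x z -> x i <> z i ->
     is_coupling (P i x z) (kappa i (restr (upto i) x))
                           (kappa i (restr (upto i) z)))
  (f : prodspace E -> R) (mf : measurable_fun [set: prodspace E] f)
  (lipf : lipschitz_rho rho f)
  (t : R) (t_ge0 : (0 <= t)%R) :
  Pr [set w | t%:E <= `| (f (X w))%:E - 'E_Pr[f \o X] |] <=
  2%:E * expeR (- ((2 * t ^+ 2)%:E /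
                   l2norm_sq (mulmv (Gamma rho P) (local_osc rho f)))).
Proof.
set v := mulmv _ _.
have [B fB] := lipschitz_bounded rho_metric rho_bounded lipf.
have mEf : measurable_fun [set: prodspace E] (EFin \o f).
  exact/measurable_EFinP.
have mfX : measurable_fun [set: Omega] (f \o X) by exact: measurableT_comp.
have EX : 'E_Pr[f \o X] = (fine (\int[mu]_x (f x)%:E))%:E.
  transitivity (\int[mu]_x (f x)%:E); last first.
    rewrite fineK//; apply: integrable_fin_num => //.
    exact: (integrable_of_norm_bound (probability_setT mu) mf fB).
  rewrite unlock; transitivity (\int[distribution Pr X]_x (EFin \o f) x).
    rewrite integral_distribution//.
    exact: (integrable_of_norm_bound (probability_setT Pr) mfX
      (fun w => fB (X w))).
  by apply: eq_measure_integral => A mA _; exact: lawX.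
set e := fine _ in EX.
pose A : set (prodspace E) := [set x | t <= `|f x - e|]%R.
have mA : measurable A.
  apply: measurable_superlevel.
  by apply: measurableT_comp => //; exact: measurable_funB.
have -> : Pr [set w | t%:E <= `|(f (X w))%:E - 'E_Pr[f \o X]|] = mu A.
  by rewrite -lawX// EX.
have v0 i : 0 <= v i.
  apply: sume_ge0 => j _.
  by apply: mule_ge0; [exact: Gamma_ge0 | exact: local_osc_ge0].
(* An infinite entry makes the squared norm infinite and the exponent 0, so the bound is 2 and holds
   trivially. *)
have [vfin|/existsNP[i vi]] := pselect (forall i, v i \is a fin_num).
  have -> : l2norm_sq v = (\sum_i fine (v i) ^+ 2)%:E.
    by rewrite -sumEFin; apply: eq_bigr => i _; rewrite EFin_expe fineK.
  apply: (two_sided_tail rho_metric rho_meas rho_bounded kappaP couplingP mf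
    lipf) => // i.
  by rewrite fineK.
have -> : l2norm_sq v = +oo.
  have vy : v i = +oo.
    by move: (v0 i) vi; case: (v i) => // r _ /negP; rewrite fin_numE.
  rewrite /l2norm_sq (bigD1 i)//= vy addye//.
  rewrite gt_eqF// (lt_le_trans ltNy0)//; apply: sume_ge0 => j _.
  exact: mule_ge0.
rewrite invey mule0 oppe0 /= expR0 mule1.
by apply: (le_trans (probability_le1 _ mA)); rewrite lee_fin ler1n.
Qed.
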